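(* There exists a randomness-type prediction system $\mathcal{D}=(\mathcal{D}_m)_{m\in\mathbb{N}_0}$ such that, for any randomness-type prediction system $\Lambda=(\Lambda_m)_{m\in\mathbb{N}_0}$, there exists $c\in\mathbb{N}$ such that, for all $m\in\mathbb{N}_0$, $\Lambda_{m+c}\subseteq\mathcal{D}_m$.
   Context: $\mathbf{X}$ is a fixed finite set of binary strings, $\mathbb{2}:=\{0,1\}$, $\mathbb{N}=\{1,2,\ldots\}$, $\mathbb{N}_0=\{0,1,2,\ldots\}$. For $\omega\in(\mathbf{X}\times\mathbb{2})^\infty$, $\omega^i$ denotes the prefix of $\omega$ of length $i$. A randomness-type prediction system is a family $\Lambda=(\Lambda_m)_{m\in\mathbb{N}_0}$ of sets $\Lambda_m\subseteq(\mathbf{X}\times\mathbb{2})^*$ that is jointly enumerable (the set $\{(\sigma,m)\mid\sigma\in\Lambda_m\}$ is recursively enumerable) and such that: (i) $\Lambda_0\supseteq\Lambda_1\supseteq\Lambda_2\supseteq\cdots$; (ii) for all $m\in\mathbb{N}_0$, $l\in\mathbb{N}$, and $\omega\in(\mathbf{X}\times\mathbb{2})^\infty$, $|\{i\in\{1,\ldots,l\}\mid\omega^i\in\Lambda_m\}|\le2^{-m}l$. *)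

(* Defs.v *)
From mathcomp Require Import all_boot all_order all_algebra.
From mathcomp Require Import finmap.
From mathcomp Require Import boolp classical_sets.

Set Implicit Arguments.
Unset Strict Implicit.
Unset Printing Implicit Defensive.

Local Open Scope classical_set_scope.

(** Kleene's schemes: [recfun k] is the syntax of the [k]-ary partial recursive
    functions, and [sem f v y] says that [f] is defined at [v] with value [y]. *)
Inductive recfun : nat -> Type :=
| Zero : recfun 0
| Succ : recfun 1
| Proj k (i : 'I_k) : recfun k
| Comp k l (f : recfun l) (g : 'I_l -> recfun k) : recfun k
| PrimRec k (f : recfun k) (g : recfun k.+2) : recfun k.+1
| Mu k (f : recfun k.+1) : recfun k.

(** In [PrimRec] the recursion is on the first argument and [r] lists the
    successive values.  In [Mu] the values below the least zero must be
    defined. *)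
Fixpoint sem k (f : recfun k) : k.-tuple nat -> nat -> Prop :=
  match f in recfun k return k.-tuple nat -> nat -> Prop with
  | Zero => fun _ y => y = 0
  | Succ => fun v y => y = (thead v).+1
  | Proj _ i => fun v y => y = tnth v i
  | Comp _ l f g => fun v y =>
      exists w : l.-tuple nat, (forall i, sem (g i) v (tnth w i)) /\ sem f w y
  | PrimRec k f g => fun v y =>
      let xs : k.-tuple nat := [tuple of behead v] in
      exists r : nat -> nat,
        [/\ sem f xs (r 0),
            forall i, i < thead v -> sem g [tuple of i :: r i :: xs] (r i.+1)
          & y = r (thead v)]
  | Mu _ f => fun v y =>
      sem f [tuple of y :: v] 0 /\
      forall i, i < y -> exists z, sem f [tuple of i :: v] z.+1
  end.

(** [A] is the domain of a partial recursive function, elements of [T] being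
    represented by their numbers [choice.pickle t] (not the unrelated [pickle]
    of finmap).  This is meant for types with an effective numbering: for
    [seq (X * bool) * nat] with [X] finite, an element of [X] is numbered by its
    index in an enumeration of [X], and [CodeSeq.code] does the rest. *)
Definition recursively_enumerable (T : countType) (A : set T) : Prop :=
  exists f : recfun 1, forall t, A t <-> exists y, sem f [tuple choice.pickle t] y.

(** The infinite sequence [w] has [w n] as its [n.+1]-th element, so that
    [mkseq w i] is its prefix of length [i]. *)
Record prediction_system (X : {fset seq bool})
    (L : nat -> set (seq (X * bool))) : Prop := PredictionSystem {
  ps_enumerable :
    recursively_enumerable [set p : seq (X * bool) * nat | L p.2 p.1];
  ps_nested : forall m, L m.+1 `<=` L m;
  ps_frequency : forall (m l : nat) (w : nat -> X * bool), 0 < l ->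
    (#|[pred i : 'I_l.+1 | (0 < i)%N && `[< L m (mkseq w i) >]]|%:R
       <= 2 ^- m * l%:R :> rat)%R
}.

(* Main.v *)
Require Import Defs.
From mathcomp Require Import all_boot all_order all_algebra.
From mathcomp Require Import finmap.
From mathcomp Require Import boolp classical_sets.
From mathcomp Require Import zify.

(** As in the construction of a universal Martin-Löf test, one enumerates all
    the candidate systems: the [e]-th one is the domain of the [e]-th program,
    and it contributes its level [m + e + 1] to level [m] of the universal
    system, the frequencies adding up to at most [2^-m].  A domain that is not a
    prediction system is not followed beyond the stages at which the finite set
    enumerated so far satisfies the frequency bounds; these need only be checked
    along the prefixes of the words of that set.

    Running all the programs effectively requires a universal machine: each
    [recfun] is compiled to the code of a program for a stack machine whose
    transition function on codes of states is computable. *)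

Set Implicit Arguments.
Unset Strict Implicit.
Unset Printing Implicit Defensive.

Import Order.TTheory GRing.Theory Num.Theory.

Local Open Scope classical_set_scope.

(** * Computable functions *)

(** Only total functions are considered. [F] takes plain lists, of which only those of length [k]
    matter, so that arguments are reached by [nth] and [behead] instead of through tuples. *)
Definition computable_seq (k : nat) (F : seq nat -> nat) : Prop :=
  exists f : recfun k, forall (v : k.-tuple nat) y, sem f v y <-> y = F v.

Lemma computable_seq_ext k (F G : seq nat -> nat) :
  (forall v, F v = G v) -> computable_seq k F -> computable_seq k G.
Proof. by move=> FG [f Hf]; exists f => v y; rewrite Hf FG. Qed.

Lemma computable_seq_nth k i :
  i < k -> computable_seq k (fun v => nth 0 v i).
Proof.
move=> ik; exists (Proj (Ordinal ik)) => v y /=.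
by rewrite (tnth_nth 0).
Qed.

Lemma computable_seq_comp k l (F : seq nat -> nat) (G : seq (seq nat -> nat)) :
  size G = l -> computable_seq l F ->
  (forall i, i < l -> computable_seq k (nth (fun=> 0) G i)) ->
  computable_seq k (fun v => F [seq g v | g <- G]).
Proof.
move=> sG [f Hf] HG.
have /choice [g Hg] : forall i : 'I_l, exists g : recfun k,
    forall (v : k.-tuple nat) y, sem g v y <-> y = nth (fun=> 0) G i v.
  by move=> i; apply: HG.
exists (Comp f g) => v y /=.
have sizeGv : size [seq g (tval v) | g <- G] == l by rewrite size_map sG.
pose w := Tuple sizeGv.
have Hw (i : 'I_l) : tnth w i = nth (fun=> 0) G i v.
  by rewrite (tnth_nth 0) /= (nth_map (fun=> 0)) ?sG.
split=> [[w' [Hw' /Hf ->]]|->].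
  suff -> : w' = w by [].
  by apply: eq_from_tnth => i; rewrite Hw; apply/Hg.
by exists w; split=> [i|]; [apply/Hg; rewrite Hw|apply/Hf].
Qed.

Definition computable (F : nat -> nat) : Prop :=
  computable_seq 1 (fun v => F (nth 0 v 0)).
Definition computable2 (F : nat -> nat -> nat) : Prop :=
  computable_seq 2 (fun v => F (nth 0 v 0) (nth 0 v 1)).

Lemma computable_seq_comp1 k (h : nat -> nat) (F : seq nat -> nat) :
  computable h -> computable_seq k F ->
  computable_seq k (fun v => h (F v)).
Proof.
move=> Hh HF.
apply: (@computable_seq_comp k 1 (fun v => h (nth 0 v 0)) [:: F]) => //.
by case.
Qed.

Lemma computable_seq_comp2 k (h : nat -> nat -> nat) (F G : seq nat -> nat) :
  computable2 h ->
  computable_seq k F -> computable_seq k G ->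
  computable_seq k (fun v => h (F v) (G v)).
Proof.
move=> Hh HF HG.
apply: (@computable_seq_comp k 2 (fun v => h (nth 0 v 0) (nth 0 v 1)) [:: F; G])
  => //.
by case=> [|[]].
Qed.

Lemma computable_seq_rec k (a : seq nat -> nat)
    (g : nat -> nat -> seq nat -> nat) :
  computable_seq k a ->
  computable_seq k.+2 (fun v => g (nth 0 v 0) (nth 0 v 1) (behead (behead v))) ->
  computable_seq k.+1 (fun v =>
    nat_rect (fun=> nat) (a (behead v)) (fun i r => g i r (behead v))
      (nth 0 v 0)).
Proof.
move=> [f Hf] [h Hh]; exists (PrimRec f h) => v y /=.
pose R := nat_rect (fun=> nat) (a (behead v)) (fun i r => g i r (behead v)).
have -> : nth 0 v 0 = thead v by rewrite /thead (tnth_nth 0).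
split=> [[r [/Hf /= r0 rS ->]]|->].
  have : thead v <= thead v by [].
  elim: {1 3 4}(thead v) => [_|i IH iv] //=.
  by move/Hh: (rS i iv) => /= ->; rewrite IH // ltnW.
by exists R; split=> [|i _|//]; [apply/Hf|apply/Hh].
Qed.

(** [Mu] looks for a least zero, so the test enters negated; as [P] is total, every value below the
    minimum is defined and equal to 1, a successor. *)
Lemma computable_seq_mu k (P : seq nat -> bool) (G : seq nat -> nat) :
  computable_seq k.+1 (fun v => ~~ P v : nat) ->
  (forall v, P (G v :: v) /\ forall i, P (i :: v) -> G v <= i) ->
  computable_seq k G.
Proof.
move=> [f Hf] HG; exists (Mu f) => v y /=.
have [PG Gmin] := HG v; split=> [[/Hf /= Py ylt]|->].
  have {}Py : P (y :: v) by case: (P _) Py.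
  apply/eqP; rewrite eqn_leq Gmin // andbT leqNgt.
  apply/negP => /ylt [z /Hf /=].
  by rewrite PG.
split=> [|i iG]; first by apply/Hf; rewrite /= PG.
exists 0; apply/Hf => /=; case: (boolP (P _)) => // /Gmin.
by rewrite leqNgt iG.
Qed.

(** * Coding of finite lists of numbers by numbers *)

(** This is the step of [CodeSeq.code], with 0 for the empty list: the head is the 2-adic valuation
    and the tail is read off the odd part. It serves as a pairing function as well. *)
Definition consn (n c : nat) : nat := 2 ^ n * c.*2.+1.
Definition headn (c : nat) : nat := head 0 (CodeSeq.decode c).
Definition tailn (c : nat) : nat := CodeSeq.code (behead (CodeSeq.decode c)).

Lemma code_cons n s : CodeSeq.code (n :: s) = consn n (CodeSeq.code s).
Proof. by []. Qed.

Lemma code_seq1 n : CodeSeq.code [:: n] = consn n 0.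
Proof. by []. Qed.

Lemma decode_cons n c : CodeSeq.decode (consn n c) = n :: CodeSeq.decode c.
Proof. by rewrite -{1}[c]CodeSeq.decodeK -code_cons CodeSeq.codeK. Qed.

Lemma headn_cons n c : headn (consn n c) = n.
Proof. by rewrite /headn decode_cons. Qed.

Lemma tailn_cons n c : tailn (consn n c) = c.
Proof. by rewrite /tailn decode_cons /= CodeSeq.decodeK. Qed.

Lemma consn_neq0 n c : (consn n c == 0) = false.
Proof. by rewrite /consn muln_eq0 expn_eq0. Qed.

Lemma consn_headn_tailn c : c != 0 -> consn (headn c) (tailn c) = c.
Proof.
move=> c0; rewrite /headn /tailn; case E: (CodeSeq.decode c) => [|n s].
  by move: c0; rewrite -[c]CodeSeq.decodeK E.
by rewrite -code_cons -E CodeSeq.decodeK.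
Qed.

Lemma headn_code s : headn (CodeSeq.code s) = head 0 s.
Proof. by rewrite /headn CodeSeq.codeK. Qed.

Lemma tailn_code s : tailn (CodeSeq.code s) = CodeSeq.code (behead s).
Proof. by rewrite /tailn CodeSeq.codeK. Qed.

Lemma code_eq0 s : (CodeSeq.code s == 0) = (s == [::]).
Proof. by case: s => //= n s; rewrite consn_neq0. Qed.

Lemma iter_tailn i c : iter i tailn c = CodeSeq.code (drop i (CodeSeq.decode c)).
Proof.
elim: i => [|i IH]; first by rewrite drop0 CodeSeq.decodeK.
by rewrite iterS IH tailn_code -[behead _]drop1 drop_drop add1n.
Qed.

(** * Computability of arithmetic and of the list operations *)

Lemma computable_ext (F G : nat -> nat) :
  (forall x, F x = G x) -> computable F -> computable G.
Proof. by move=> FG; apply: computable_seq_ext => v. Qed.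

Lemma computable_id : computable (fun x => x).
Proof. exact: computable_seq_nth. Qed.

Lemma computable_seq_succ k F :
  computable_seq k F -> computable_seq k (fun v => (F v).+1).
Proof.
apply: computable_seq_comp1; exists Succ => v y /=.
by rewrite /thead (tnth_nth 0).
Qed.

Lemma computable_seq_const k n : computable_seq k (fun=> n).
Proof.
elim: n => [|n]; last exact: computable_seq_succ.
apply: (@computable_seq_comp k 0 (fun=> 0) [::]) => //.
by exists Zero.
Qed.

Lemma computable2_add : computable2 addn.
Proof.
have H : computable_seq 2 (fun v => nat_rect (fun=> nat) (nth 0 (behead v) 0)
    (fun i r => r.+1) (nth 0 v 0)).
  apply: (@computable_seq_rec 1 (fun v => nth 0 v 0) (fun i r _ => r.+1)).
    exact: computable_seq_nth.
  exact/computable_seq_succ/computable_seq_nth.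
apply: computable_seq_ext H => v; rewrite nth_behead.
by elim: (nth 0 v 0) => //= n ->.
Qed.

Lemma computable_seq_double k F :
  computable_seq k F -> computable_seq k (fun v => (F v).*2).
Proof.
move=> HF; apply: (@computable_seq_ext _ (fun v => F v + F v)) => [v|].
  by rewrite addnn.
exact: (computable_seq_comp2 computable2_add HF HF).
Qed.

Lemma computable2_cons : computable2 consn.
Proof.
have H : computable_seq 2 (fun v => nat_rect (fun=> nat)
    (nth 0 (behead v) 0).*2.+1 (fun i r => r.*2) (nth 0 v 0)).
  apply: (@computable_seq_rec 1 (fun v => (nth 0 v 0).*2.+1) (fun i r _ => r.*2)).
    exact/computable_seq_succ/computable_seq_double/computable_seq_nth.
  exact/computable_seq_double/computable_seq_nth.
apply: computable_seq_ext H => v; rewrite nth_behead /consn.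
elim: (nth 0 v 0) => [|n IH]; first by rewrite mul1n.
by rewrite [LHS]/= IH expnS -mulnA mul2n.
Qed.

Lemma computable_nat_rect (a : nat) (g : nat -> nat -> nat) :
  computable2 g -> computable (nat_rect (fun=> nat) a g).
Proof.
move=> Hg; apply: (@computable_seq_rec 0 (fun=> a) (fun i r _ => g i r)) => //.
exact: computable_seq_const.
Qed.

Lemma computable_pred : computable predn.
Proof.
have H := @computable_nat_rect 0 (fun i r => i).
by apply: computable_ext (H _) => [[]|] //; apply: computable_seq_nth.
Qed.

Lemma computable_negb (P : nat -> bool) :
  computable (fun x => P x : nat) -> computable (fun x => ~~ P x : nat).
Proof.
move=> HP; have H := @computable_nat_rect 1 (fun _ _ => 0).
have {}H := computable_seq_comp1 (H (computable_seq_const _ _)) HP.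
by apply: computable_seq_ext H => v; case: (P _).
Qed.

Lemma computable_odd : computable (fun x => odd x : nat).
Proof.
have H := @computable_nat_rect 0 (fun i r => r == 0).
apply: computable_ext (H _) => [|].
  by elim=> //= n ->; case: (odd n).
have H1 := @computable_nat_rect 1 (fun _ _ => 0).
have {}H1 := @computable_seq_comp1 2 _ (fun v => nth 0 v 1)
  (H1 (computable_seq_const _ _)).
apply: computable_seq_ext (H1 _) => [v|]; first by case: (nth 0 v 1).
exact: computable_seq_nth.
Qed.

Lemma computable_half : computable half.
Proof.
have H := @computable_nat_rect 0 (fun i r => odd i + r).
apply: computable_ext (H _) => [|].
  by elim=> // n /= ->; rewrite uphalf_half.
apply: (@computable_seq_comp2 2 addn (fun v => odd (nth 0 v 0))
  (fun v => nth 0 v 1) computable2_add); last exact: computable_seq_nth.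
by apply: (computable_seq_comp1 computable_odd); apply: computable_seq_nth.
Qed.

Lemma computable2_iter_half : computable2 (fun i c => iter i half c).
Proof.
have H : computable_seq 2 (fun v => nat_rect (fun=> nat)
    (nth 0 (behead v) 0) (fun i r => r./2) (nth 0 v 0)).
  apply: (@computable_seq_rec 1 (fun v => (nth 0 v 0)) (fun i r _ => r./2)).
    exact: computable_seq_nth.
  by apply: (computable_seq_comp1 computable_half); apply: computable_seq_nth.
apply: computable_seq_ext H => v; rewrite nth_behead.
by elim: (nth 0 v 0) => //= n ->.
Qed.

Lemma iter_half_cons i n c : i <= n -> iter i half (consn n c) = consn (n - i) c.
Proof.
elim: i => [|i IH] lt_in; first by rewrite subn0.
by rewrite iterS IH 1?ltnW // /consn -(subnSK lt_in) expnS -mulnA mul2n doubleK.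
Qed.

Lemma odd_cons n c : odd (consn n c) = (n == 0).
Proof.
by case: n => [|n]; rewrite /consn ?mul1n /= ?odd_double // expnS -mulnA oddM.
Qed.

(** The head is a 2-adic valuation, hence the least number of halvings that leads to an odd
    number. *)
Lemma computable_headn : computable headn.
Proof.
(* Halving 0 never gives an odd number; the second summand makes the search stop at once there, with
   the value [headn 0 = 0]. *)
pose P i c := odd (iter i half c + (c == 0)).
apply: (@computable_seq_mu 1 (fun v => P (nth 0 v 0) (nth 0 v 1))
  (fun v => headn (nth 0 v 0))) => [|v /=].
  apply: (@computable_seq_comp1 2 (fun x => ~~ odd x : nat)
    (fun v => iter (nth 0 v 0) half (nth 0 v 1) + (nth 0 v 1 == 0))).
    exact: computable_negb computable_odd.
  apply: (@computable_seq_comp2 2 addn _ (fun v => nth 0 v 1 == 0)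
    computable2_add); first exact: computable2_iter_half.
  have H := @computable_nat_rect 1 (fun _ _ => 0) (computable_seq_const _ _).
  have {}H := @computable_seq_comp1 2 _ (fun v => nth 0 v 1) H
    (@computable_seq_nth 2 1 isT).
  by apply: computable_seq_ext H => v; case: (nth 0 v 1).
rewrite /P; case: (eqVneq (nth 0 v 0) 0) => [->|c0] /=.
  by split=> //; elim.
rewrite -(consn_headn_tailn c0) headn_cons.
set n := headn _; set c := tailn _; split=> [|i]; rewrite addn0.
  by rewrite iter_half_cons // subnn odd_cons.
have [//|lt_i] := leqP; rewrite iter_half_cons 1?ltnW // odd_cons.
by rewrite subn_eq0 leqNgt lt_i.
Qed.

(** Halving as often as the head says leaves the odd part, and one more halving gives the tail. *)
Lemma computable_tailn : computable tailn.
Proof.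
have H1 : computable (fun c => iter (headn c) half c).
  exact: (computable_seq_comp2 computable2_iter_half computable_headn
    computable_id).
have {}H1 : computable (fun c => (iter (headn c) half c)./2).
  exact: (computable_seq_comp1 computable_half H1).
apply: computable_ext H1 => c.
have [->|c0] := eqVneq c 0; first by [].
rewrite -(consn_headn_tailn c0) headn_cons tailn_cons iter_half_cons // subnn.
by rewrite /consn mul1n /= uphalf_double.
Qed.

Lemma computable_comp (h F : nat -> nat) :
  computable h -> computable F -> computable (fun x => h (F x)).
Proof. exact: computable_seq_comp1. Qed.

Lemma computable_comp2 (h : nat -> nat -> nat) (F G : nat -> nat) :
  computable2 h -> computable F -> computable G ->
  computable (fun x => h (F x) (G x)).
Proof. exact: computable_seq_comp2. Qed.

(** Pairs are coded by [consn], so that the closure properties below need only unary functions. *)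
Lemma computable2_uncurry (g : nat -> nat -> nat) :
  computable (fun z => g (headn z) (tailn z)) -> computable2 g.
Proof.
move=> Hg; have H := computable_seq_comp1 Hg computable2_cons.
by apply: computable_seq_ext H => v; rewrite headn_cons tailn_cons.
Qed.

Opaque consn headn tailn.

Lemma computable_const n : computable (fun=> n).
Proof. exact: computable_seq_const. Qed.

Lemma computable_succ F : computable F -> computable (fun x => (F x).+1).
Proof. exact: computable_seq_succ. Qed.

Lemma computable_predn F : computable F -> computable (fun x => (F x).-1).
Proof. exact: (computable_comp computable_pred). Qed.

Lemma computable_head F : computable F -> computable (fun x => headn (F x)).
Proof. exact: (computable_comp computable_headn). Qed.

Lemma computable_tail F : computable F -> computable (fun x => tailn (F x)).
Proof. exact: (computable_comp computable_tailn). Qed.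

Lemma computable_cons F G : computable F -> computable G ->
  computable (fun x => consn (F x) (G x)).
Proof. exact: (computable_comp2 computable2_cons). Qed.

Lemma computable_add F G : computable F -> computable G ->
  computable (fun x => F x + G x).
Proof. exact: (computable_comp2 computable2_add). Qed.

(** Primitive recursion with [x] carried along as a parameter; most bounded computations below are
    instances of this loop. *)
Lemma computable_iter (N Z : nat -> nat) (S : nat -> nat -> nat) :
  computable N -> computable Z -> computable (fun z => S (headn z) (tailn z)) ->
  computable (fun x => iter (N x) (S x) (Z x)).
Proof.
move=> HN HZ HS.
suff H : computable2 (fun n x => iter n (S x) (Z x)).
  exact: (computable_comp2 H HN computable_id).
have H : computable_seq 2 (fun v => nat_rect (fun=> nat) (Z (nth 0 (behead v) 0))
    (fun i r => S (nth 0 (behead v) 0) r) (nth 0 v 0)).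
  apply: (@computable_seq_rec 1 (fun v => Z (nth 0 v 0))
    (fun i r w => S (nth 0 w 0) r)) => //.
  apply: (@computable_seq_ext _ (fun v => S (nth 0 v 2) (nth 0 v 1))) => [v|].
    by rewrite !nth_behead.
  by apply: (@computable_seq_comp2 3 S); first exact: computable2_uncurry;
    exact: computable_seq_nth.
apply: computable_seq_ext H => v; rewrite nth_behead.
by elim: (nth 0 v 0) => //= n ->.
Qed.

Lemma computable_app2 (F : nat -> nat -> nat) (A B : nat -> nat) :
  computable (fun z => F (headn z) (tailn z)) -> computable A -> computable B ->
  computable (fun x => F (A x) (B x)).
Proof. by move=> /computable2_uncurry; apply: computable_comp2. Qed.

(* The match is syntactic: [consn 0 x] is convertible to a successor, and
   [nat_of_bool] to a conditional. *)
Ltac computability := repeat first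
  [ assumption | exact: computable_const
  | exact: computable_headn | exact: computable_tailn
  | lazymatch goal with
    | |- computable (fun x => x) => exact: computable_id
    | |- computable (fun x => S _) => apply: computable_succ
    | |- computable (fun x => predn _) => apply: computable_predn
    | |- computable (fun x => headn _) => apply: computable_head
    | |- computable (fun x => tailn _) => apply: computable_tail
    | |- computable (fun x => consn _ _) => apply: computable_cons
    | |- computable (fun x => addn _ _) => apply: computable_add
    end ].

(** * Conditionals, bounded sums and quantifiers, and operations on coded words *)

Lemma computable_if (P : nat -> bool) (F G : nat -> nat) :
  computable (fun x => P x : nat) -> computable F -> computable G ->
  computable (fun x => if P x then F x else G x).
Proof.
move=> HP HF HG.
(* A conditional is a loop run once or not at all. *)
have H : computable (fun x => iter (P x) (fun=> F x) (G x)).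
  apply: (@computable_iter _ _ (fun x _ => F x)) => //.
  by apply: computable_comp HF _; computability.
by apply: computable_ext H => x; case: (P x).
Qed.

Lemma computable_and (P Q : nat -> bool) :
  computable (fun x => P x : nat) -> computable (fun x => Q x : nat) ->
  computable (fun x => P x && Q x : nat).
Proof.
move=> HP HQ; have H := computable_if HP HQ (computable_const 0).
by apply: computable_ext H => x; case: (P x).
Qed.

Lemma computable_imply (P Q : nat -> bool) :
  computable (fun x => P x : nat) -> computable (fun x => Q x : nat) ->
  computable (fun x => P x ==> Q x : nat).
Proof.
move=> HP HQ; have H := computable_if HP HQ (computable_const 1).
by apply: computable_ext H => x; case: (P x).
Qed.

Lemma computable_sub F G : computable F -> computable G ->
  computable (fun x => F x - G x).
Proof.
move=> HF HG.
apply: (@computable_ext (fun x => iter (G x) predn (F x))) => [x|].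
  by elim: (G x) => [|n IH]; rewrite ?subn0 // iterS IH subnS.
by apply: (@computable_iter _ _ (fun _ => predn)) => //; computability.
Qed.

Lemma computable_eq0 F : computable F -> computable (fun x => F x == 0 : nat).
Proof.
move=> HF; apply: (@computable_ext (fun x => 1 - F x)) => [x|].
  by case: (F x).
by apply: computable_sub; computability.
Qed.

Lemma computable_leq F G : computable F -> computable G ->
  computable (fun x => F x <= G x : nat).
Proof. by move=> HF HG; apply/computable_eq0/computable_sub. Qed.

Lemma computable_eq F G : computable F -> computable G ->
  computable (fun x => F x == G x : nat).
Proof.
move=> HF HG.
apply: (@computable_ext (fun x => (F x <= G x) && (G x <= F x))) => [x|].
  by rewrite -eqn_leq.
by apply: computable_and; apply: computable_leq.
Qed.

Lemma computable_mul F G : computable F -> computable G ->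
  computable (fun x => F x * G x).
Proof.
move=> HF HG.
apply: (@computable_ext (fun x => iter (F x) (addn (G x)) 0)) => [x|].
  by rewrite iter_addn_0 mulnC.
apply: (@computable_iter _ _ (fun x c => G x + c)); computability.
by apply: (computable_comp HG); computability.
Qed.

Lemma computable_exp2 F : computable F -> computable (fun x => 2 ^ F x).
Proof.
move=> HF.
apply: (@computable_ext (fun x => iter (F x) (fun c => c + c) 1)) => [x|].
  by elim: (F x) => //= n ->; rewrite addnn -mul2n expnS.
by apply: (@computable_iter _ _ (fun x c => c + c)); computability.
Qed.

Lemma computable_sum (N : nat -> nat) (F : nat -> nat -> nat) :
  computable N -> computable (fun z => F (headn z) (tailn z)) ->
  computable (fun x => \sum_(i < N x) F x i).
Proof.
move=> HN HF.
(* The loop state pairs the current index with the partial sum. *)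
pose St x c := consn (headn c).+1 (tailn c + F x (headn c)).
have St_iter x n : iter n (St x) (consn 0 0) = consn n (\sum_(i < n) F x i).
  elim: n => [|n IH]; first by rewrite big_ord0.
  by rewrite iterS IH /St headn_cons tailn_cons big_ord_recr.
apply: (@computable_ext (fun x => tailn (iter (N x) (St x) (consn 0 0)))) => [x|].
  by rewrite St_iter tailn_cons.
apply/computable_tail/computable_iter; rewrite /St; computability.
by apply: (computable_app2 HF); computability.
Qed.

Lemma computable_has (N : nat -> nat) (P : nat -> nat -> bool) :
  computable N -> computable (fun z => P (headn z) (tailn z) : nat) ->
  computable (fun x => has (P x) (iota 0 (N x)) : nat).
Proof.
move=> HN HP.
apply: (@computable_ext (fun x => 1 <= \sum_(i < N x) P x i)) => [x|].
  rewrite -(big_mkord xpredT (fun i => P x i : nat)) /index_iota subn0 lt0n.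
  rewrite sum_nat_seq_neq0; congr nat_of_bool; apply: eq_has => i /=.
  by case: (P x i).
apply: computable_leq; computability.
exact: (@computable_sum N (fun x i => P x i)).
Qed.

Lemma computable_all (N : nat -> nat) (P : nat -> nat -> bool) :
  computable N -> computable (fun z => P (headn z) (tailn z) : nat) ->
  computable (fun x => all (P x) (iota 0 (N x)) : nat).
Proof.
move=> HN HP.
apply: (@computable_ext (fun x => ~~ has (fun i => ~~ P x i) (iota 0 (N x)))) => [x|].
  by rewrite -all_predC; congr nat_of_bool; apply: eq_all => i /=; rewrite negbK.
apply: computable_negb; apply: (@computable_has N (fun x i => ~~ P x i)) => //.
exact: computable_negb.
Qed.

Lemma computable_mem (cs : seq nat) F : computable F ->
  computable (fun x => F x \in cs : nat).
Proof.
move=> HF; elim: cs => [|c cs IH]; first exact: computable_const.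
have H := computable_if (computable_eq HF (computable_const c))
  (computable_const 1) IH.
by apply: computable_ext H => x; rewrite inE; case: (F x == c).
Qed.

Lemma computable_iter_tail (N F : nat -> nat) : computable N -> computable F ->
  computable (fun x => iter (N x) tailn (F x)).
Proof.
by move=> HN HF; apply: (@computable_iter _ _ (fun _ => tailn)); computability.
Qed.

(** This turns quantifiers over positions in a coded list into quantifiers bounded by the code
    itself. *)
Lemma size_decode s : size (CodeSeq.decode s) <= s.
Proof.
rewrite -{2}[s]CodeSeq.decodeK; elim: (CodeSeq.decode s) => //= n r IH.
apply: (@leq_trans (CodeSeq.code r).*2.+1); last by rewrite leq_pmull ?expn_gt0.
by rewrite ltnS -addnn (leq_trans IH) ?leq_addr.
Qed.

Lemma computable_all_decode (cs : seq nat) F : computable F ->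
  computable (fun x => all (mem cs) (CodeSeq.decode (F x)) : nat).
Proof.
(* The [i]-th suffix has a nonzero code exactly when position [i] exists, and its head is then the
   [i]-th entry. *)
move=> HF; pose P x i := let r := iter i tailn (F x) in
  ~~ (r == 0) ==> (headn r \in cs).
have HP : computable (fun x => all (P x) (iota 0 (F x)) : nat).
  apply: computable_all => //.
  have Hr : computable (fun z => iter (tailn z) tailn (F (headn z))).
    by apply: computable_iter_tail; [|apply: (computable_comp HF)]; computability.
  apply: computable_imply; first exact/computable_negb/computable_eq0.
  exact/computable_mem/computable_head.
apply: computable_ext HP => x; congr nat_of_bool; rewrite /P.
have := size_decode (F x); set n := F x; set s := CodeSeq.decode n => lt_sn.
apply/allP/(all_nthP 0) => H i.
  move=> lt_is; have := H i; rewrite mem_iota add0n (leq_trans lt_is) //.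
  rewrite /= iter_tailn code_eq0 headn_code -nth0 nth_drop addn0.
  by rewrite -size_eq0 size_drop subn_eq0 -ltnNge lt_is /=; apply.
move=> _ /=; rewrite iter_tailn code_eq0 headn_code -nth0 nth_drop addn0.
rewrite -size_eq0 size_drop subn_eq0 -ltnNge; apply/implyP; exact: H.
Qed.

Lemma computable_size_decode F : computable F ->
  computable (fun x => size (CodeSeq.decode (F x))).
Proof.
move=> HF; pose P x i := ~~ (iter i tailn (F x) == 0).
have HP : computable (fun x => \sum_(i < F x) P x i).
  apply: (@computable_sum F (fun x i => P x i)) => //.
  apply/computable_negb/computable_eq0/computable_iter_tail; computability.
  by apply: (computable_comp HF); computability.
apply: computable_ext HP => x; rewrite /P.
have := size_decode (F x).
set n := F x; set s := CodeSeq.decode n => le_sn.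
transitivity (\sum_(i < n) (i < size s)).
  apply: eq_bigr => i _; rewrite iter_tailn code_eq0 -size_eq0 size_drop.
  by rewrite subn_eq0 -ltnNge.
move: {s}n (size s) le_sn => n l le_ln.
rewrite -[RHS](minn_idPr le_ln); elim: {le_ln}n => [|n IH].
  by rewrite big_ord0 min0n.
by rewrite big_ord_recr /= {}IH; lia.
Qed.

(** Moving [N x] entries onto an accumulator yields the reversed prefix. Doing so again restores the
    order, as the reversed prefix has at most [N x] entries. *)
Lemma computable_take_decode N F : computable N -> computable F ->
  computable (fun x => CodeSeq.code (take (N x) (CodeSeq.decode (F x)))).
Proof.
(* In [mv] the head of the state codes the entries left and its tail codes the accumulator; once no
   entry is left the state no longer changes. *)
move=> HN HF.
pose mv c := if headn c == 0 then c else
  consn (tailn (headn c)) (consn (headn (headn c)) (tailn c)).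
have Hmv M G : computable M -> computable G ->
    computable (fun x => tailn (iter (M x) mv (consn (G x) 0))).
  move=> HM HG; apply: computable_tail.
  apply: (@computable_iter _ _ (fun _ => mv)) => //; computability.
  apply: computable_if; last by computability.
    by apply: computable_eq0; computability.
  by computability.
have mvE i s acc : iter i mv (consn (CodeSeq.code s) (CodeSeq.code acc)) =
    consn (CodeSeq.code (drop i s)) (CodeSeq.code (catrev (take i s) acc)).
  elim: i s acc => [|i IH] s acc; first by rewrite drop0 take0.
  rewrite iterSr {2}/mv headn_cons tailn_cons code_eq0 headn_code tailn_code.
  case: s => [|x s] /=; last by rewrite -code_cons IH.
  by rewrite (IH [::]) /=.
have revE i s : tailn (iter i mv (consn (CodeSeq.code s) 0)) =
    CodeSeq.code (rev (take i s)).
  by rewrite (mvE i s [::]) tailn_cons.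
have H := Hmv _ _ HN (Hmv _ _ HN HF).
apply: computable_ext H => x; rewrite -{1}[F x]CodeSeq.decodeK !revE.
by rewrite [take _ (rev _)]take_oversize ?revK // size_rev size_take; case: ltnP.
Qed.

Opaque CodeSeq.code.

(** * A universal machine *)

(* A state is [consn K S] with [K] the list of the programs still to be run and
   [S] the stack of values; a program is [consn tag payload]. *)
Definition mzero := consn 0 0.
Definition msucc := consn 1 0.
Definition mpred := consn 2 0.
Definition mhead := consn 3 0.
Definition mtail := consn 4 0.
Definition mdup := consn 5 0.
Definition mswap := consn 6 0.
Definition mcons := consn 7 0.
Definition mseq a b := consn 8 (consn a b).
(* Runs [a] as long as the head of the top value is not 0. *)
Definition mloop a := consn 9 a.

(** Every number is a state, so every number can be run as a program. A state with no program left
    is a fixed point, whence halting persists. *)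
Definition mstep (z : nat) : nat :=
  let c := headn (headn z) in let K := tailn (headn z) in
  let S := tailn z in let x := headn S in let S' := tailn S in
  if headn z == 0 then z else
  if headn c == 0 then consn K (consn 0 S') else
  if headn c == 1 then consn K (consn x.+1 S') else
  if headn c == 2 then consn K (consn x.-1 S') else
  if headn c == 3 then consn K (consn (headn x) S') else
  if headn c == 4 then consn K (consn (tailn x) S') else
  if headn c == 5 then consn K (consn x S) else
  if headn c == 6 then consn K (consn (headn S') (consn x (tailn S'))) else
  if headn c == 7 then consn K (consn (consn (headn S') x) (tailn S')) else
  if headn c == 8
  then consn (consn (headn (tailn c)) (consn (tailn (tailn c)) K)) S else
  if headn x == 0 then consn K S else consn (consn (tailn c) (headn z)) S.

Lemma computable_mstep F : computable F -> computable (fun x => mstep (F x)).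
Proof.
have H : computable mstep.
  rewrite /mstep /=; repeat lazymatch goal with
    | |- computable (fun x => nat_of_bool _) => apply: computable_eq
    | |- computable (fun x => if _ then _ else _) => apply: computable_if
    | |- _ => progress computability
    end.
exact: computable_comp.
Qed.

(** * Runs of the machine *)

Definition reach (z z' : nat) := exists n, iter n mstep z = z'.
(** Quantifying over the remaining programs and the rest of the stack makes runs composable. *)
Definition run (c x y : nat) := forall K S,
  reach (consn (consn c K) (consn x S)) (consn K (consn y S)).

Lemma reach_trans z2 z1 z3 : reach z1 z2 -> reach z2 z3 -> reach z1 z3.
Proof. by move=> [n <-] [m <-]; exists (m + n); rewrite iterD. Qed.

Lemma reach_step z1 z2 : reach (mstep z1) z2 -> reach z1 z2.
Proof. by move=> [n <-]; exists n.+1; rewrite iterSr. Qed.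

Lemma reach_refl z : reach z z.
Proof. by exists 0. Qed.

Ltac mstep_simpl := rewrite /mstep ?(headn_cons, tailn_cons, consn_neq0) /=.

Lemma run_prim c x y :
  (forall K S, mstep (consn (consn c K) (consn x S)) = consn K (consn y S)) ->
  run c x y.
Proof. by move=> H K S; exists 1; rewrite /= H. Qed.

Lemma run_zero x : run mzero x 0.
Proof. by apply: run_prim => K S; mstep_simpl. Qed.
Lemma run_succ x : run msucc x x.+1.
Proof. by apply: run_prim => K S; mstep_simpl. Qed.
Lemma run_pred x : run mpred x x.-1.
Proof. by apply: run_prim => K S; mstep_simpl. Qed.
Lemma run_head x : run mhead x (headn x).
Proof. by apply: run_prim => K S; mstep_simpl. Qed.
Lemma run_tail x : run mtail x (tailn x).
Proof. by apply: run_prim => K S; mstep_simpl. Qed.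

Lemma mstep_seq a b K S : mstep (consn (consn (mseq a b) K) S) =
  consn (consn a (consn b K)) S.
Proof. by mstep_simpl. Qed.
Lemma mstep_dup K x S : mstep (consn (consn mdup K) (consn x S)) =
  consn K (consn x (consn x S)).
Proof. by mstep_simpl. Qed.
Lemma mstep_swap K x y S : mstep (consn (consn mswap K) (consn x (consn y S))) =
  consn K (consn y (consn x S)).
Proof. by mstep_simpl. Qed.
Lemma mstep_cons K x y S : mstep (consn (consn mcons K) (consn x (consn y S))) =
  consn K (consn (consn y x) S).
Proof. by mstep_simpl. Qed.
Lemma mstep_loop a K x S : mstep (consn (consn (mloop a) K) (consn x S)) =
  if headn x == 0 then consn K (consn x S)
  else consn (consn a (consn (mloop a) K)) (consn x S).
Proof. by mstep_simpl. Qed.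

Lemma run_seq y a b x z : run a x y -> run b y z -> run (mseq a b) x z.
Proof.
move=> ra rb K S; apply: reach_step; rewrite mstep_seq.
exact: reach_trans (ra _ _) (rb _ _).
Qed.

(** The input is duplicated; [a] consumes one copy, the swap brings up the other one for [b], and
    the two results are joined. *)
Definition mpair a b := mseq mdup (mseq a (mseq mswap (mseq b mcons))).

Lemma run_pair a b x y z : run a x y -> run b x z ->
  run (mpair a b) x (consn y z).
Proof.
move=> ra rb K S.
apply: reach_step; rewrite mstep_seq; apply: reach_step; rewrite mstep_dup.
apply: reach_step; rewrite mstep_seq; apply: reach_trans (ra _ _) _.
apply: reach_step; rewrite mstep_seq; apply: reach_step; rewrite mstep_swap.
apply: reach_step; rewrite mstep_seq; apply: reach_trans (rb _ _) _.
by apply: reach_step; rewrite mstep_cons; apply: reach_refl.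
Qed.

Lemma run_loop_end a x : headn x = 0 -> run (mloop a) x x.
Proof. by move=> x0; apply: run_prim => K S; rewrite mstep_loop x0. Qed.

Lemma run_loop y a x z : headn x != 0 -> run a x y -> run (mloop a) y z ->
  run (mloop a) x z.
Proof.
move=> x0 ra rl K S; apply: reach_step; rewrite mstep_loop (negbTE x0).
exact: reach_trans (ra _ _) (rl _ _).
Qed.

(** * Halting within a number of steps *)

Definition halts (n z : nat) : bool := headn (iter n mstep z) == 0.

Lemma halts_mono n m z : n <= m -> halts n z -> halts m z.
Proof.
move=> /subnK <-; rewrite /halts iterD; set z' := iter n _ _ => z'0.
elim: (m - n) => //= k IH; rewrite {1}/mstep.
by rewrite IH.
Qed.

(** The machine is deterministic, so a state met on the way needs no more steps than the initial
    one. *)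
Lemma halts_reach n z z' : reach z z' -> halts n z -> halts n z'.
Proof.
move=> [m <-] H; rewrite /halts -iterD addnC; apply: halts_mono H.
by rewrite leq_addl.
Qed.

Lemma halts_step n z : halts n z -> halts n.-1 (mstep z).
Proof.
case: n => [|n]; last by rewrite /halts iterSr.
by rewrite /halts /= /mstep => z0; rewrite z0.
Qed.

(** The context is existential because a part of a halting program halts together with whatever is
    left to run after it; the parts thus inherit the bound [n]. *)
Definition defined (n c x : nat) := exists K S,
  halts n (consn (consn c K) (consn x S)).

Lemma defined_le n m c x : n <= m -> defined n c x -> defined m c x.
Proof. by move=> nm [K [S /(halts_mono nm) H]]; exists K, S. Qed.

Lemma defined_seq n a b x : defined n (mseq a b) x ->
  defined n a x /\ forall y, run a x y -> defined n b y.
Proof.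
move=> [K [S /halts_step]]; rewrite mstep_seq => /(halts_mono (leq_pred n)) H.
split; first by do 2!eexists; exact: H.
by move=> y ra; exists K, S; apply: halts_reach H.
Qed.

Lemma defined_pair n a b x : defined n (mpair a b) x ->
  defined n a x /\ forall y, run a x y -> defined n b x.
Proof.
move=> [K [S H]].
have {}H : halts n (consn (consn a (consn (mseq mswap (mseq b mcons)) K))
    (consn x (consn x S))).
  apply: halts_reach H.
  apply: reach_step; rewrite mstep_seq; apply: reach_step; rewrite mstep_dup.
  by apply: reach_step; rewrite mstep_seq; apply: reach_refl.
split; first by do 2!eexists; exact: H.
move=> y ra; exists (consn mcons K), (consn y S); apply: halts_reach H.
apply: reach_trans (ra _ _) _.
apply: reach_step; rewrite mstep_seq; apply: reach_step; rewrite mstep_swap.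
by apply: reach_step; rewrite mstep_seq; apply: reach_refl.
Qed.

(** Entering the body costs a step. This strict decrease is what allows induction on the bound when
    the number of rounds is unknown. *)
Lemma defined_loop n a x : headn x != 0 -> defined n (mloop a) x ->
  0 < n /\
  (defined n.-1 a x /\ forall y, run a x y -> defined n.-1 (mloop a) y).
Proof.
move=> x0 [K [S]]; case: n => [|n].
  by rewrite /halts /= headn_cons consn_neq0.
move/halts_step; rewrite mstep_loop (negbTE x0) /= => H; split=> //.
split; first by do 2!eexists; exact: H.
by move=> y ra; exists K, S; apply: halts_reach H.
Qed.

(** * Compilation of recursive functions *)

Fixpoint mnth i := if i is i.+1 then mseq mtail (mnth i) else mhead.

Lemma run_nth i s : run (mnth i) (CodeSeq.code s) (nth 0 s i).
Proof.
elim: i s => [|i IH] s; first by rewrite nth0 -headn_code; apply: run_head.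
apply: run_seq (run_tail _) _; rewrite tailn_code -nth_behead; exact: IH.
Qed.

(** The identity, obtained as the tail of the pair of the input with itself. *)
Definition mid := mseq mdup (mseq mcons mtail).

Lemma run_id x : run mid x x.
Proof.
move=> K S; apply: reach_step; rewrite mstep_seq.
apply: reach_step; rewrite mstep_dup; apply: reach_step; rewrite mstep_seq.
apply: reach_step; rewrite mstep_cons.
by have := run_tail (consn x x) K S; rewrite tailn_cons.
Qed.

(* The loop for primitive recursion works on the list [n, i, r & xs] with [n]
   steps remaining and [r] the [i]-th value. *)
Definition mrec_init f :=
  mpair mhead (mpair mzero (mpair (mseq mtail f) mtail)).
Definition mrec_body g :=
  mpair (mseq mhead mpred)
    (mseq mtail (mpair (mseq mhead msucc) (mpair g (mseq mtail mtail)))).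
(* The loop for minimization works on the list [z, y & xs] with [z] the value
   of [f] at [y :: xs]. *)
Definition mmu_body f :=
  mseq mtail (mseq (mpair (mseq mhead msucc) mtail) (mpair f mid)).

(** Arguments are passed as one coded list. [Comp] builds the list of inner values by nested pairs
    ending in 0, the empty list; the two loops leave their result at position 2, the last value, and
    at position 1, the minimum. *)
Fixpoint compile k (f : recfun k) : nat :=
  match f with
  | Zero => mzero
  | Succ => mseq mhead msucc
  | Proj _ i => mnth i
  | Comp _ l f g => mseq
      (foldr (fun i c => mpair (compile (g i)) c) mzero (enum 'I_l)) (compile f)
  | PrimRec _ f g => mseq (mrec_init (compile f))
      (mseq (mloop (mrec_body (compile g))) (mnth 2))
  | Mu _ f => mseq (mpair mzero mid) (mseq (mpair (compile f) mid)
      (mseq (mloop (mmu_body (compile f))) (mnth 1)))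
  end.

Lemma run_code_head n xs : run mhead (CodeSeq.code (n :: xs)) n.
Proof. by rewrite -{2}[n]/(head 0 (n :: xs)) -headn_code; apply: run_head. Qed.

Lemma run_code_tail n xs : run mtail (CodeSeq.code (n :: xs)) (CodeSeq.code xs).
Proof. by rewrite -{2}[xs]/(behead (n :: xs)) -tailn_code; apply: run_tail. Qed.

Lemma run_rec_init f n xs r :
  run f (CodeSeq.code xs) r ->
  run (mrec_init f) (CodeSeq.code (n :: xs)) (CodeSeq.code [:: n, 0, r & xs]).
Proof.
move=> rf; rewrite (code_cons n [:: 0, r & xs]); apply: run_pair.
  exact: run_code_head.
rewrite (code_cons 0); apply: run_pair; first exact: run_zero.
have rt := run_code_tail n xs.
by rewrite (code_cons r); apply: run_pair => //; apply: run_seq rt _.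
Qed.

Lemma run_rec_body g n i r xs r' :
  run g (CodeSeq.code [:: i, r & xs]) r' ->
  run (mrec_body g) (CodeSeq.code [:: n, i, r & xs])
    (CodeSeq.code [:: n.-1, i.+1, r' & xs]).
Proof.
move=> rg; rewrite (code_cons n.-1); apply: run_pair.
  by apply: run_seq (run_code_head _ _) (run_pred _).
apply: run_seq (run_code_tail _ _) _; rewrite (code_cons i.+1); apply: run_pair.
  by apply: run_seq (run_code_head _ _) (run_succ _).
rewrite (code_cons r'); apply: run_pair => //.
exact: run_seq (run_code_tail _ _) (run_code_tail _ _).
Qed.

(** The sum [n + i] is invariant, which permits induction on the countdown [n] with [i] general. *)
Lemma run_rec_loop g (r : nat -> nat) xs n i :
  (forall j, j < n + i -> run g (CodeSeq.code [:: j, r j & xs]) (r j.+1)) ->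
  run (mloop (mrec_body g)) (CodeSeq.code [:: n, i, r i & xs])
    (CodeSeq.code [:: 0, n + i, r (n + i) & xs]).
Proof.
elim: n i => [|n IH] i rg; first by apply: run_loop_end; rewrite headn_code.
apply: run_loop; first by rewrite headn_code.
  by apply: run_rec_body; apply: rg; rewrite addSn ltnS leq_addl.
by rewrite addSnnS; apply: IH => j; rewrite -addSnnS; apply: rg.
Qed.

Lemma run_mu_body f y z xs z' : run f (CodeSeq.code (y.+1 :: xs)) z' ->
  run (mmu_body f) (CodeSeq.code [:: z, y & xs]) (CodeSeq.code [:: z', y.+1 & xs]).
Proof.
move=> rf; apply: run_seq (run_code_tail _ _) _.
apply: (@run_seq (CodeSeq.code (y.+1 :: xs))).
  rewrite code_cons; apply: run_pair; last exact: run_code_tail.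
  exact: run_seq (run_code_head _ _) (run_succ _).
by rewrite (code_cons z'); apply: run_pair rf (run_id _).
Qed.

Lemma run_mu_loop f y n xs (r : nat -> nat) :
  (forall i, i <= y + n -> run f (CodeSeq.code (i :: xs)) (r i)) ->
  (forall i, i < y + n -> r i != 0) -> r (y + n) = 0 ->
  run (mloop (mmu_body f)) (CodeSeq.code [:: r y, y & xs])
    (CodeSeq.code [:: 0, y + n & xs]).
Proof.
elim: n y => [|n IH] y rf rlt r0.
  by rewrite addn0 in r0 *; rewrite r0; apply: run_loop_end; rewrite headn_code.
apply: run_loop; first by rewrite headn_code /= rlt // addnS ltnS leq_addr.
  by apply: run_mu_body; apply: rf; rewrite -addSnnS leq_addr.
by rewrite -addSnnS in rf rlt r0 *; apply: IH.
Qed.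

Lemma run_map l (g : 'I_l -> nat) (w : 'I_l -> nat) x (s : seq 'I_l) :
  (forall i, run (g i) x (w i)) ->
  run (foldr (fun i c => mpair (g i) c) mzero s) x (CodeSeq.code [seq w i | i <- s]).
Proof.
move=> rg; elim: s => [|i s IH]; first exact: run_zero.
exact: run_pair.
Qed.

(** Induction on [f]; the witnesses in [sem], namely inner values or the sequence of recursive
    values, are the intermediate results of the machine. *)
Lemma run_compile k (f : recfun k) (v : k.-tuple nat) y :
  sem f v y -> run (compile f) (CodeSeq.code v) y.
Proof.
elim: f v y => {k} [||k i|k l f IHf g IHg|k f IHf g IHg|k f IHf] v y.
- by move=> ->; apply: run_zero.
- move=> ->; apply: run_seq (run_head _) _; rewrite headn_code.
  by rewrite -nth0 /thead (tnth_nth 0); apply: run_succ.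
- by move=> ->; rewrite (tnth_nth 0); apply: run_nth.
- move=> [w [Hw Hy]] /=; apply: (@run_seq (CodeSeq.code w)); last exact: IHf.
  rewrite -[w in run _ _ (_ w)]map_tnth_enum /=.
  by apply: (@run_map _ (fun i => compile (g i)) (tnth w)) => i; exact: IHg (Hw i).
- move=> [r [r0 rS ->]] /=.
  case/tupleP: v r0 rS => n xs; rewrite theadE => r0 rS.
  have {}r0 := IHf _ _ r0; rewrite /= in r0.
  apply: run_seq (run_rec_init _ r0) _.
  have := @run_rec_loop (compile g) r xs n 0.
  rewrite !addn0 => rl; apply: run_seq (rl _) _; last exact: (run_nth 2).
  by move=> j /rS /IHg.
- move=> [Hy rlt] /=.
  (* The values of [f] up to the minimum [y], where the first zero occurs; beyond [y] the value 0 is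
     a mere default. *)
  have /choice [r Hr] i : exists z, i <= y ->
      sem f [tuple of i :: v] z /\ (z == 0) = (i == y).
    case: (ltngtP i y) => [/rlt [z Hz]|_|->]; [exists z.+1|exists 0|exists 0] => //.
  have rf i : i <= 0 + y -> run (compile f) (CodeSeq.code (i :: v)) (r i).
    by move=> /Hr [/IHf].
  have ry : r y = 0 by apply/eqP; rewrite (proj2 (Hr y _)) ?eqxx.
  have rv : run mid (CodeSeq.code v) (CodeSeq.code v) by apply: run_id.
  apply: run_seq (run_pair (run_zero _) rv) _.
  apply: run_seq (run_pair (rf 0 isT) (run_id _)) _.
  apply: (run_seq (run_mu_loop (y := 0) (n := y) rf _ ry)); last exact: (run_nth 1).
  by move=> i lt_iy; rewrite (proj2 (Hr i (ltnW lt_iy))) ltn_eqF.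
Qed.

(** * Halting of compiled programs implies definedness *)

Lemma defined_map n l (g : 'I_l -> nat) x (s : seq 'I_l) :
  (forall i, defined n (g i) x -> exists y, run (g i) x y) ->
  defined n (foldr (fun i c => mpair (g i) c) mzero s) x ->
  forall i, i \in s -> defined n (g i) x.
Proof.
move=> rg; elim: s => //= j s IH /defined_pair [dj /(_ _) ds] i.
rewrite inE => /predU1P [-> //|]; apply: IH.
by have [y /ds] := rg _ dj.
Qed.

Lemma defined_rec_body n g m i r xs :
  defined n (mrec_body g) (CodeSeq.code [:: m, i, r & xs]) ->
  defined n g (CodeSeq.code [:: i, r & xs]).
Proof.
rewrite /mrec_body => /defined_pair [_ /(_ m.-1)].
have /[swap] /[apply] : run (mseq mhead mpred) (CodeSeq.code [:: m, i, r & xs]) m.-1.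
  exact: run_seq (run_code_head _ _) (run_pred _).
move=> /defined_seq [_ /(_ _ (run_code_tail _ _))] /defined_pair [_ /(_ i.+1)].
have /[swap] /[apply] : run (mseq mhead msucc) (CodeSeq.code [:: i, r & xs]) i.+1.
  exact: run_seq (run_code_head _ _) (run_succ _).
by move=> /defined_pair [].
Qed.

Lemma defined_rec_init n f m xs :
  defined n (mrec_init f) (CodeSeq.code (m :: xs)) ->
  defined n f (CodeSeq.code xs).
Proof.
rewrite /mrec_init => /defined_pair [_ /(_ _ (run_code_head _ _))].
move=> /defined_pair [_ /(_ _ (run_zero _))] /defined_pair [+ _].
by move=> /defined_seq [_ /(_ _ (run_code_tail _ _))].
Qed.

Lemma defined_mu_body n f y z xs :
  defined n (mmu_body f) (CodeSeq.code [:: z, y & xs]) ->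
  defined n f (CodeSeq.code (y.+1 :: xs)).
Proof.
rewrite /mmu_body => /defined_seq [_ /(_ _ (run_code_tail _ _))].
move=> /defined_seq [_ /(_ (CodeSeq.code (y.+1 :: xs)))].
have /[swap] /[apply] : run (mpair (mseq mhead msucc) mtail)
    (CodeSeq.code (y :: xs)) (CodeSeq.code (y.+1 :: xs)).
  rewrite (code_cons y.+1); apply: run_pair; last exact: run_code_tail.
  exact: run_seq (run_code_head _ _) (run_succ _).
by move=> /defined_pair [].
Qed.

(** Induction on [f]: each part of the program halts on its input, the induction hypothesis gives it
    a value, and by [run_compile] the machine continues with that value. *)
Lemma compile_defined k (f : recfun k) n (v : k.-tuple nat) :
  defined n (compile f) (CodeSeq.code v) -> exists y, sem f v y.
Proof.
elim: f n v => {k} [||k i|k l f IHf g IHg|k f IHf g IHg|k f IHf] n v.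
- by exists 0.
- by exists (thead v).+1.
- by exists (tnth v i).
- move=> /= /defined_seq [dg df].
  have {dg} dg i : defined n (compile (g i)) (CodeSeq.code v).
    apply: (defined_map _ dg); last exact: mem_enum.
    by move=> j /IHg [y /run_compile]; exists y.
  have /choice [w Hw] i := IHg _ _ _ (dg i).
  have [y Hy] : exists y, sem f [tuple w i | i < l] y.
    apply: (IHf n); apply: df.
    by apply: (run_map (w := w)) => i; apply: run_compile.
  by exists y, [tuple w i | i < l]; split=> // i; rewrite tnth_mktuple.
- case/tupleP: v => m xs /= /defined_seq [/defined_rec_init /IHf [r0 Hr0]].
  have rinit := run_rec_init m (run_compile Hr0).
  move=> /(_ _ rinit) /defined_seq [dl _].
  (* The recursive values are found one at a time, while the loop is known to halt from the state
     reached after [i] rounds. *)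
  have H : forall i, i <= m -> exists r : nat -> nat,
      [/\ r 0 = r0, forall j, j < i ->
          sem g [tuple of j :: r j :: xs] (r j.+1)
        & defined n (mloop (mrec_body (compile g)))
            (CodeSeq.code [:: m - i, i, r i & xs])].
    elim=> [|i IH] lt_im; first by exists (fun=> r0); rewrite subn0.
    have [r [r_0 rS]] := IH (ltnW lt_im).
    have nz : headn (CodeSeq.code [:: m - i, i, r i & xs]) != 0.
      by rewrite headn_code /= subn_eq0 -ltnNge.
    move=> /(defined_loop nz) [_ [/defined_rec_body db /(_ _) dl']].
    have [y Hy] := IHg n.-1 [tuple of i :: r i :: xs] db.
    have := dl' _ (run_rec_body (m - i) (run_compile Hy)).
    rewrite -subnS => /(defined_le (leq_pred n)) d.
    exists (fun j => if j == i.+1 then y else r j).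
    split; [exact: r_0| |by rewrite eqxx].
    move=> j; rewrite ltnS => le_ji; rewrite ltn_eqF // eqSS.
    have [->//|ne_ji] := eqVneq j i.
    by apply: rS; rewrite ltn_neqAle ne_ji.
  have [r [r_0 rS _]] := H m (leqnn m).
  have xsE : [tuple of behead [tuple of m :: xs]] = xs by apply: val_inj.
  exists (r m), r; split=> [|i|//]; first by rewrite xsE r_0.
  rewrite theadE => /rS; congr (sem _ _ _); exact: val_inj.
- move=> /= /defined_seq [_ /(_ _ (run_pair (run_zero _) (run_id _)))].
  rewrite -(code_cons 0) => /defined_seq [/defined_pair [/(IHf n [tuple of 0 :: v])]].
  move=> [z0 Hz0] _ /(_ _ (run_pair (run_compile Hz0) (run_id _))).
  rewrite -(code_cons z0) => /defined_seq [dl _].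
  (* Nothing bounds the minimum in advance; the induction is on the step bound [m], which drops with
     each round. *)
  have H m y z : defined m (mloop (mmu_body (compile f)))
        (CodeSeq.code [:: z, y & v]) -> sem f [tuple of y :: v] z ->
      exists y', sem f [tuple of y' :: v] 0 /\
        forall i, y <= i < y' -> exists z, sem f [tuple of i :: v] z.+1.
    elim: m y z => [|m IH] y [|z] d Hz.
    - by exists y; split=> // i; rewrite ltnNge andbN.
    - suff /defined_loop /(_ d) [] :
        headn (CodeSeq.code [:: z.+1, y & v]) != 0 by [].
      by rewrite headn_code.
    - by exists y; split=> // i; rewrite ltnNge andbN.
    have nz : headn (CodeSeq.code [:: z.+1, y & v]) != 0 by rewrite headn_code.
    have [_ [/defined_mu_body db dl']] := defined_loop nz d.
    have [z' Hz'] := IHf _ [tuple of y.+1 :: v] db.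
    have [y' [Hy' lt_y']] := IH _ _ (dl' _ (run_mu_body _ (run_compile Hz'))) Hz'.
    exists y'; split=> // i /andP[].
    rewrite leq_eqVlt => /predU1P [<- _|lt_yi lt_iy'].
      by exists z.
    by apply: lt_y'; rewrite lt_yi.
  have [y [Hy lt_y]] := H _ _ _ dl Hz0.
  by exists y; split.
Qed.

Opaque CodeSeq.decode.

(** * The universal prediction system *)

(** Compiled programs expect a coded argument list, hence the one-element list [consn x 0] on top of
    the stack. *)
Definition halted (e x k : nat) : bool :=
  halts k (consn (consn e 0) (consn (consn x 0) 0)).

Lemma halted_compile (f : recfun 1) x :
  (exists y, sem f [tuple x] y) <-> exists k, halted (compile f) x k.
Proof.
split=> [[y /run_compile /(_ 0 0) [k Hk]]|[k Hk]].
  by exists k; rewrite /halted /halts -code_seq1 Hk headn_cons.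
by apply: (@compile_defined _ _ k); exists 0, 0.
Qed.

Lemma computable_halted E X K : computable E -> computable X -> computable K ->
  computable (fun z => halted (E z) (X z) (K z) : nat).
Proof.
move=> HE HX HK; apply/computable_eq0/computable_head.
apply: (@computable_iter _ _ (fun _ => mstep)) => //; computability.
by apply: computable_mstep; computability.
Qed.

(* Stage [n] of the enumeration of the domain of program [e], closed under
   decreasing the level [j]. *)
Definition stage (e n j s : nat) : bool :=
  (s < n) && has (fun j' => (j <= j') &&
    has (halted e (consn s (consn j' 0))) (iota 0 n)) (iota 0 n).

Lemma computable_stage E N J S :
  computable E -> computable N -> computable J -> computable S ->
  computable (fun z => stage (E z) (N z) (J z) (S z) : nat).
Proof.
move=> HE HN HJ HS; apply: computable_and.
  by apply: computable_leq; computability.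
pose P z j := (J z <= j) &&
  has (halted (E z) (consn (S z) (consn j 0))) (iota 0 (N z)).
apply: (@computable_has N P) => //; apply: computable_and.
  apply: computable_leq; computability.
  by apply: (computable_comp HJ); computability.
pose Q z k := halted (E (headn z)) (consn (S (headn z)) (consn (tailn z) 0)) k.
apply: (@computable_has (fun z => N (headn z)) Q).
  by apply: (computable_comp HN); computability.
apply: computable_halted; computability.
  by apply: (computable_comp HE); computability.
by apply: (computable_comp HS); computability.
Qed.

Lemma stage_mono e n n' j s : n <= n' -> stage e n j s -> stage e n' j s.
Proof.
move=> le_nn' /andP[lt_sn /hasP[j' + /andP[le_jj' /hasP[k + Hk]]]].
rewrite !mem_iota !add0n /= => lt_j'n lt_kn.
rewrite /stage (leq_trans lt_sn) //=; apply/hasP; exists j'.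
  by rewrite mem_iota (leq_trans lt_j'n).
rewrite le_jj' /=; apply/hasP; exists k => //.
by rewrite mem_iota (leq_trans lt_kn).
Qed.

Lemma stage_anti e n j j' s : j <= j' -> stage e n j' s -> stage e n j s.
Proof.
move=> le_jj' /andP[lt_sn /hasP[i Hi /andP[le_j'i Hk]]].
rewrite /stage lt_sn /=; apply/hasP; exists i => //.
by rewrite (leq_trans le_jj') ?le_j'i.
Qed.

Lemma stage_lt e n j s : stage e n j s -> (j < n) && (s < n).
Proof.
move=> /andP[-> /hasP[j' + /andP[le_jj' _]]].
by rewrite mem_iota /= add0n andbT; apply: leq_ltn_trans.
Qed.

(* The frequency bounds at stage [n]; [cs] lists the codes of the letters, and
   numbers that do not code words are disregarded. *)
Definition sparse (cs : seq nat) (e n : nat) : bool :=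
  all (fun s => all (mem cs) (CodeSeq.decode s) ==>
    all (fun j => stage e n j s ==>
      (2 ^ j * \sum_(i < size (CodeSeq.decode s))
         stage e n j (CodeSeq.code (take i.+1 (CodeSeq.decode s)))
       <= size (CodeSeq.decode s))) (iota 0 n)) (iota 0 n).

Lemma computable_sparse cs E N : computable E -> computable N ->
  computable (fun z => sparse cs (E z) (N z) : nat).
Proof.
move=> HE HN.
pose C z s j := \sum_(i < size (CodeSeq.decode s))
  stage (E z) (N z) j (CodeSeq.code (take i.+1 (CodeSeq.decode s))).
pose P z s := all (mem cs) (CodeSeq.decode s) ==>
  all (fun j => stage (E z) (N z) j s ==>
    (2 ^ j * C z s j <= size (CodeSeq.decode s))) (iota 0 (N z)).
apply: (@computable_all N P) => //; apply: computable_imply.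
  by apply: computable_all_decode; computability.
pose Q y j := let z := headn y in let s := tailn y in
  stage (E z) (N z) j s ==> (2 ^ j * C z s j <= size (CodeSeq.decode s)).
apply: (@computable_all (fun y => N (headn y)) Q).
  by apply: (computable_comp HN); computability.
have HEh : computable (fun y => E (headn (headn y))).
  by apply: (computable_comp HE); computability.
have HNh : computable (fun y => N (headn (headn y))).
  by apply: (computable_comp HN); computability.
apply: computable_imply; first by apply: computable_stage; computability.
apply: computable_leq; last by apply: computable_size_decode; computability.
apply: computable_mul; first by apply: computable_exp2; computability.
pose T x i := stage (E (headn (headn x))) (N (headn (headn x))) (tailn x)
  (CodeSeq.code (take i.+1 (CodeSeq.decode (tailn (headn x))))).
apply: (@computable_sum (fun x => size (CodeSeq.decode (tailn (headn x)))) T).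
  by apply: computable_size_decode; computability.
apply: computable_stage; computability.
- by apply: (computable_comp HEh); computability.
- by apply: (computable_comp HNh); computability.
by apply: computable_take_decode; computability.
Qed.

(** The projection of a decidable relation is the domain of the unbounded search for a witness. *)
Lemma computable_ex (R : nat -> nat -> bool) :
  computable (fun z => R (headn z) (tailn z) : nat) ->
  exists f : recfun 1,
    forall x, (exists n, R x n) <-> exists y, sem f [tuple x] y.
Proof.
move=> HR.
have [f Hf] : computable2 (fun n x => ~~ R x n).
  apply: computable2_uncurry; apply: computable_negb.
  by apply: (@computable_app2 (fun x n => R x n)) => //; computability.
exists (Mu f) => x; split=> [exR|[y [/Hf /= Ry _]]]; last first.
  by exists y; case: (R x y) Ry.
case: (ex_minnP exR) => n Rn min_n; exists n; split.
  by apply/Hf; rewrite /= Rn.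
move=> i lt_in; exists 0; apply/Hf => /=; case: (boolP (R x i)) => // /min_n.
by rewrite leqNgt lt_in.
Qed.

(** * Words over a finite alphabet and frequencies along their prefixes *)

Section Words.
Variable Y : finType.

Definition letters : seq nat := [seq choice.pickle y | y <- enum Y].

Lemma pickle_word (s : seq Y) :
  choice.pickle s = CodeSeq.code [seq choice.pickle y | y <- s].
Proof. by []. Qed.

(** This is the form of input on which [stage] runs the programs. *)
Lemma pickle_word_nat (s : seq Y) (m : nat) :
  choice.pickle (s, m) = consn (choice.pickle s) (consn m 0).
Proof. by []. Qed.

Lemma word_pickle (c : nat) : all (mem letters) (CodeSeq.decode c) ->
  exists s : seq Y, c = choice.pickle s.
Proof.
rewrite -{2}[c]CodeSeq.decodeK; elim: (CodeSeq.decode c) => [|a r IH] /=.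
  by exists [::].
move=> /andP[/mapP[y _ ->] /IH [s]]; rewrite pickle_word => Hs.
by exists (y :: s); rewrite pickle_word !code_cons Hs.
Qed.

Lemma letters_pickle (s : seq Y) :
  all (mem letters) (CodeSeq.decode (choice.pickle s)).
Proof.
rewrite pickle_word CodeSeq.codeK; apply/allP => _ /mapP[y _ ->].
by apply: map_f; rewrite mem_enum.
Qed.

(** The bounded quantifiers in [sparse] lose nothing, since a stage contains only levels and codes
    below [n], and the numbers passing the letter test are the codes of words. *)
Lemma sparseP e n : reflect
  (forall (s : seq Y) j, stage e n j (choice.pickle s) ->
    2 ^ j * \sum_(i < size s) stage e n j (choice.pickle (take i.+1 s))
      <= size s)
  (sparse letters e n).
Proof.
have sumE (s : seq Y) j :
    \sum_(i < size s) stage e n j (choice.pickle (take i.+1 s)) =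
    \sum_(i < size (CodeSeq.decode (choice.pickle s)))
      stage e n j (CodeSeq.code (take i.+1 (CodeSeq.decode (choice.pickle s)))).
  rewrite pickle_word CodeSeq.codeK size_map.
  by apply: eq_bigr => i _; rewrite pickle_word map_take.
have sizeE (s : seq Y) : size (CodeSeq.decode (choice.pickle s)) = size s.
  by rewrite pickle_word CodeSeq.codeK size_map.
apply: (iffP allP) => [H s j Hs|H c _].
  have /andP[lt_jn lt_sn] := stage_lt Hs.
  have := H (choice.pickle s); rewrite mem_iota lt_sn letters_pickle.
  move=> /(_ isT) /allP /(_ j); rewrite mem_iota lt_jn Hs => /(_ isT).
  by rewrite -sumE sizeE.
apply/implyP => /word_pickle [s ->]; apply/allP => j _; apply/implyP => /H.
by rewrite -sumE sizeE.
Qed.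

Definition universal_system (m : nat) : set (seq Y) :=
  [set s | exists e n,
    sparse letters e n && stage e n (m + e.+1) (choice.pickle s)].

Lemma universal_system_re :
  recursively_enumerable [set p : seq Y * nat | universal_system p.2 p.1].
Proof.
(* A single number [z] codes the program and the stage; [x] codes the word and its level. *)
pose R x z := sparse letters (headn z) (tailn z) &&
  stage (headn z) (tailn z) (headn (tailn x) + (headn z).+1) (headn x).
have [|f Hf] := @computable_ex R.
  apply: computable_and.
    by apply: computable_sparse; computability.
  by apply: computable_stage; computability.
exists f => -[s m]; apply: iff_trans (Hf _).
rewrite pickle_word_nat /R !headn_cons !tailn_cons headn_cons.
split=> [[e [n H]]|[z H]]; last by exists (headn z), (tailn z).
by exists (consn e n); rewrite headn_cons tailn_cons.
Qed.

(** Only finitely many prefixes are concerned, so one sparse stage contains all those that are ever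
    accepted, and its bounds apply to the count. *)
Lemma stage_frequency e j (w : nat -> Y) l :
  2 ^ j * \sum_(i < l) `[< exists n, sparse letters e n &&
      stage e n j (choice.pickle (mkseq w i.+1)) >] <= l.
Proof.
pose Q i := exists n,
  sparse letters e n && stage e n j (choice.pickle (mkseq w i.+1)).
(* The first alternative is kept apart because, without an accepted prefix, no sparse stage is at
   hand. *)
have [noQ|[n [/sparseP Hn Q_stage]]] : (forall i, i < l -> ~ Q i) \/
    exists n, sparse letters e n /\
      forall i, i < l -> Q i -> stage e n j (choice.pickle (mkseq w i.+1)).
  elim: l => [|l IH]; first by left.
  have [[n /andP[sparse_n stage_n]]|nQ] := pselect (Q l).
    right; case: IH => [noQ|[n' [sparse_n' Q_stage]]].
      exists n; split=> // i; rewrite ltnS leq_eqVlt => /predU1P[->//|].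
      by move=> /noQ.
    (* The maximum is one of the two stages, hence sparse. *)
    exists (maxn n n'); split=> [|i]; first by case: (leqP n n').
    rewrite ltnS leq_eqVlt => /predU1P[->|lt_il] Qi.
      exact: stage_mono (leq_maxl _ _) _.
    exact: stage_mono (leq_maxr _ _) (Q_stage i lt_il Qi).
  case: IH => [noQ|[n [sparse_n Q_stage]]].
    by left=> i; rewrite ltnS leq_eqVlt => /predU1P[->//|/noQ].
  right; exists n; split=> // i.
  by rewrite ltnS leq_eqVlt => /predU1P[->//|/Q_stage].
  by rewrite big1 ?muln0 // => i _; rewrite (asboolF (noQ _ (ltn_ord i))).
apply: (@leq_trans
  (2 ^ j * \sum_(i < l) stage e n j (choice.pickle (mkseq w i.+1)))).
  rewrite leq_mul2l; apply/orP; right; apply: leq_sum => i _.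
  by case: asboolP => // /Q_stage ->.
(* The bound is checked directly at prefixes in the stage; at any other prefix the count has not
   grown, so the bound for the shorter one suffices. *)
elim: l {Q_stage} => [|l IH]; first by rewrite big_ord0 muln0.
case Hl: (stage e n j (choice.pickle (mkseq w l.+1))); last first.
  by rewrite big_ord_recr /= Hl addn0 leqW.
have := Hn _ _ Hl; rewrite size_mkseq; congr (_ * _ <= _).
apply: eq_bigr => i _; congr (stage _ _ _ (choice.pickle _) : nat).
by rewrite /mkseq -map_take take_iota (minn_idPl _).
Qed.

Lemma card_prefix (P : nat -> bool) l :
  #|[pred i : 'I_l.+1 | (0 < i)%N && P i]| = \sum_(i < l) P i.+1.
Proof.
rewrite -sum1_card big_mkcond big_ord_recl /= add0n.
by apply: eq_bigr => i _; rewrite inE /=; case: (P _).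
Qed.

Lemma frequency_nat (m c l : nat) :
  ((c%:R <= 2 ^- m * l%:R :> rat)%R) = (2 ^ m * c <= l).
Proof.
rewrite ler_pdivlMl ?exprn_gt0 //.
by rewrite -natrX -natrM ler_nat.
Qed.

Lemma geometric_sum m l (q : nat -> nat) E :
  (forall e, 2 ^ (m + e.+1) * q e <= l) -> 2 ^ m * \sum_(e < E) q e <= l.
Proof.
move=> Hq.
(* The partial geometric sum is [1 - 2^-E]; cleared of denominators, its missing part is the extra
   [l] that carries the induction. *)
have H : 2 ^ (m + E) * \sum_(e < E) q e + l <= 2 ^ E * l.
  elim: E => [|E IH]; first by rewrite big_ord0 muln0 mul1n.
  rewrite big_ord_recr /= mulnDr addnAC.
  have := Hq E; rewrite !addnS !expnS -!mulnA.
  move: (2 ^ (m + E) * _) (2 ^ (m + E) * q E) (2 ^ E * l) IH => a b c; lia.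
rewrite -(leq_pmul2l (expn_gt0 2 E)) mulnA -expnD addnC.
exact: leq_trans (leq_addr _ _) H.
Qed.

(** A union bound over the programs: each accepted prefix is charged to one of them, and the bounds
    for the separate programs form a geometric series. *)
Lemma universal_system_frequency m l (w : nat -> Y) :
  2 ^ m * \sum_(i < l) `[< universal_system m (mkseq w i.+1) >] <= l.
Proof.
pose Q e i := exists n, sparse letters e n &&
  stage e n (m + e.+1) (choice.pickle (mkseq w i.+1)).
have /choice [e He] i : exists e, universal_system m (mkseq w i.+1) -> Q e i.
  have [[e [n H]]|] := pselect (universal_system m (mkseq w i.+1)).
    by exists e => _; exists n.
  by exists 0.
(* The first [l] prefixes involve finitely many chosen programs, all below [E]. *)
pose E := (\max_(i < l) e i).+1.
apply: (@leq_trans (2 ^ m * \sum_(i < l) \sum_(k < E) `[< Q k i >])); last first.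
  rewrite exchange_big /=.
  by apply: (@geometric_sum m l (fun k => \sum_(i < l) `[< Q k i >])) => k;
    apply: stage_frequency.
rewrite leq_mul2l; apply/orP; right; apply: leq_sum => i _.
case: asboolP => // /He Qi.
have lt_eE : e i < E by rewrite ltnS (@leq_bigmax _ (fun i : 'I_l => e i)).
by rewrite (bigD1 (Ordinal lt_eE)) //= (asboolT Qi).
Qed.

End Words.

(** * The universal system as a prediction system and its domination of all others *)

Lemma universal_system_prediction (X : {fset seq bool}) :
  prediction_system (@universal_system (X * bool)%type).
Proof.
split; first exact: universal_system_re.
  move=> m s [e [n /andP[sparse_n stage_n]]]; exists e, n; rewrite sparse_n.
  by apply: stage_anti stage_n; rewrite leq_add2r.
move=> m l w _; rewrite frequency_nat.
rewrite (card_prefix (fun i => `[< universal_system m (mkseq w i) >])).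
exact: universal_system_frequency.
Qed.

(** Take for [e] the compiled enumerator of [L]. Its stages lie inside [L] and so inherit the
    frequency bounds; hence none of them is rejected. *)
Lemma universal_system_dominates (X : {fset seq bool})
    (L : nat -> set (seq (X * bool))) :
  prediction_system L ->
  exists e, forall m, L (m + e.+1) `<=` universal_system m.
Proof.
case=> [[f Hf] nested freq].
have L_halted s m : L m s <->
    exists k, halted (compile f) (choice.pickle (s, m)) k.
  by apply: iff_trans (Hf (s, m)) _; apply: halted_compile.
have L_mono j i s : L (i + j) s -> L j s.
  by elim: i => [//|i IH]; rewrite addSn => /nested.
pose e := compile f; exists e => m s Ls.
have /L_halted [k Hk] := Ls.
(* The stage must exceed the code of the word, its level and the halting time. *)
have [n [lt_sn lt_jn lt_kn]] : exists n,
    [/\ choice.pickle s < n, m + e.+1 < n & k < n].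
  exists (maxn (choice.pickle s) (maxn (m + e.+1) k)).+1.
  by rewrite !ltnS !leq_max !leqnn !orbT.
exists e, n; apply/andP; split; last first.
  rewrite /stage lt_sn; apply/hasP; exists (m + e.+1); first by rewrite mem_iota.
  by rewrite leqnn; apply/hasP; exists k; first by rewrite mem_iota.
(* The closure of stages under decreasing the level is harmless because [L] is nested. *)
have stage_L j t : stage e n j (choice.pickle t) -> L j t.
  move=> /andP[_ /hasP[j' _ /andP[le_jj' /hasP[k' _ Hk']]]].
  by apply: (L_mono j (j' - j)); rewrite subnK //; apply/L_halted; exists k'.
(* The empty word is treated apart: the bound for [L] is available for positive lengths only, and a
   letter is needed to prolong the word. *)
apply/sparseP => t j _; case: t => [|y t]; first by rewrite big_ord0 muln0.
(* The word is prolonged to an infinite sequence by repeating its first letter [y], the default of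
   [nth]; only prefixes within the word are counted. *)
have := freq j (size (y :: t)) (nth y (y :: t)) isT.
rewrite frequency_nat (card_prefix (fun i => `[< L j (mkseq _ i) >])).
apply: leq_trans; rewrite leq_mul2l; apply/orP; right; apply: leq_sum => i _.
case: asboolP => [_|]; first exact: leq_b1.
case Hi: (stage _ _ _ _) => // -[]; have := stage_L _ _ Hi.
congr (L _ _); apply: (@eq_from_nth _ y) => [|a].
  by rewrite size_mkseq size_takel.
by rewrite size_takel // => lt_ai; rewrite nth_mkseq // nth_take.
Qed.

Theorem theorem13 (X : {fset seq bool}) :
  exists D : nat -> set (seq (X * bool)),
    prediction_system D /\
    forall L : nat -> set (seq (X * bool)), prediction_system L ->
      exists c : nat, 0 < c /\ forall m : nat, L (m + c) `<=` D m.
Proof.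
exists (@universal_system _); split; first exact: universal_system_prediction.
by move=> L /universal_system_dominates [e He]; exists e.+1.
Qed.
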